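(* Let $n\ge m\ge 1$ be integers. Let $\bm{Q}\in\mathbb{R}^{n\times m}$ be generated according to the deflation algorithm (defined in the context) with a random ordering of the blocks. Then, for any $\bm{A}\in \mathcal{S}^{nm}_+$, we have that $$\mathbb{E}\left[\operatorname{vec}(\bm{Q})^\top \bm{A} \operatorname{vec}(\bm{Q})\right] \ \leq \ \max_{\bm{U}\in \mathbb{R}^{n \times m}:\, \bm{U}^\top \bm{U}=\bm{I}_m} \left[\operatorname{vec}(\bm{U})^\top \bm{A} \operatorname{vec}(\bm{U})\right] \ \leq \ m^2\, \mathbb{E}\left[\operatorname{vec}(\bm{Q})^\top \bm{A} \operatorname{vec}(\bm{Q})\right].$$
   Context: $\mathcal{S}^{d}_+$ is the cone of $d\times d$ real symmetric positive semidefinite matrices and $\bm{I}_d$ is the $d\times d$ identity matrix. $\operatorname{vec}(\bm{X})\in\mathbb{R}^{nm}$ stacks the columns of $\bm{X}\in\mathbb{R}^{n\times m}$. An $nm\times nm$ matrix $\bm{A}$ is viewed as an $m\times m$ array of $n\times n$ blocks, with $(i,j)$ block $\bm{A}^{(i,j)}$. The columns of $\bm{Q}$ are $\bm{q}_1,\dots,\bm{q}_m$. Deflation algorithm, with the blocks processed in the natural order: the input is a positive semidefinite matrix $\bm{A}\in\mathcal{S}^{nm}_+$. Initialize $\bm{Q}=\bm{0}$. For $i=1,\dots,m$: deflate the block $\bm{A}^{(i,i)}$ according to $\bm{q}_1,\dots,\bm{q}_{i-1}$, i.e., compute $$\bm{B} = (\bm{I}_n-\bm{q}_{i-1}\bm{q}_{i-1}^\top)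 \cdots (\bm{I}_n-\bm{q}_1\bm{q}_1^\top)\, \bm{A}^{(i,i)}\, (\bm{I}_n-\bm{q}_1\bm{q}_1^\top) \cdots (\bm{I}_n-\bm{q}_{i-1}\bm{q}_{i-1}^\top);$$ compute $\bm{v}_i \in \arg\max_{\bm{x}:\,\|\bm{x}\|_2=1} \bm{x}^\top \bm{B} \bm{x}$; define $\bm{q}_i=z_i\bm{v}_i$ with $\mathbb{P}(z_i=1)=1-\mathbb{P}(z_i=-1)=1/2$, the signs $z_1,\dots,z_m$ being i.i.d. Return the semi-orthogonal matrix $\bm{Q}$. The diagonal blocks can be processed in any order. ''With a random ordering of the blocks'' means that they are processed in the order given by a uniformly random permutation of $\{1,\dots,m\}$ instead of $1,\dots,m$ (each deflation using the columns already computed); the expectation is over this permutation and the signs. *)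

(* Defs.v *)
From mathcomp Require Import all_boot all_order all_algebra all_fingroup.
From mathcomp Require Import classical_sets reals.

Set Implicit Arguments.
Unset Strict Implicit.
Unset Printing Implicit Defensive.

Import Order.TTheory GRing.Theory Num.Theory.

Local Open Scope classical_set_scope.
Local Open Scope ring_scope.

Section Defs.
Variable R : realType.

Definition quadform k (A : 'M[R]_k) (x : 'cV[R]_k) : R := (x^T *m A *m x) 0 0.

Definition psd k (A : 'M[R]_k) : Prop :=
  A^T = A /\ forall x : 'cV[R]_k, 0 <= quadform A x.

(* The library norm `|x| on matrices is the sup norm, hence this one. *)
Definition norm2 k (x : 'cV[R]_k) : R := Num.sqrt (\sum_(i < k) x i 0 ^+ 2).

Definition argmax (T : Type) (D : set T) (f : T -> R) : set T :=
  [set x | D x /\ forall y, D y -> f y <= f x].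

Definition is_max (S : set R) (M : R) : Prop := S M /\ ubound S M.

Definition semi_orthogonal n m : set 'M[R]_(n, m) := [set U | U^T *m U = 1%:M].

(* mxvec concatenates rows, so the transpose is needed to stack columns; the
   entry X k j sits at position mxvec_index j k : 'I_(m * n), i.e. j * n + k. *)
Definition vec n m (X : 'M[R]_(n, m)) : 'cV[R]_(m * n) := (mxvec X^T)^T.

Definition blk n m (A : 'M[R]_(m * n)) (i j : 'I_m) : 'M[R]_n :=
  \matrix_(k, l) A (mxvec_index i k) (mxvec_index j l).

(* qs lists the columns in the order in which they were computed, so the first
   one gives the innermost projections. *)
Definition deflate n (C : 'M[R]_n) (qs : seq 'cV[R]_n) : 'M[R]_n :=
  foldl (fun B q => (1%:M - q *m q^T) *m B *m (1%:M - q *m q^T)) C qs.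

Definition set_col n m (Q : 'M[R]_(n, m)) (i : 'I_m) (q : 'cV[R]_n) :
    'M[R]_(n, m) :=
  \matrix_(k, j) if j == i then q k 0 else Q k j.

(* A tie-breaking rule for the arg max.  Its arguments are the blocks already
   processed (in order), the current Q, the current block index and the
   deflated block B.  The chosen vector may thus depend on the whole past of
   the run (the signs already drawn can be read off Q), but not on the current
   or later signs, nor on the order of the later blocks. *)
Definition selector n m :=
  seq 'I_m -> 'M[R]_(n, m) -> 'I_m -> 'M[R]_n -> 'cV[R]_n.

Definition selects_argmax n m (sel : selector n m) : Prop :=
  forall processed Q i B,
    argmax [set x | norm2 x = 1] (quadform B) (sel processed Q i B).

(* z i encodes the sign (-1) ^+ z i attached to block i. *)
Fixpoint deflation_loop n m (A : 'M[R]_(m * n)) (sel : selector n m)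
    (z : {ffun 'I_m -> bool}) (processed todo : seq 'I_m) (Q : 'M[R]_(n, m)) :
    'M[R]_(n, m) :=
  if todo is i :: todo' then
    let B := deflate (blk A i i) [seq col j Q | j <- processed] in
    let v := sel processed Q i B in
    deflation_loop A sel z (rcons processed i) todo'
      (set_col Q i ((-1) ^+ z i *: v))
  else Q.

(* The k-th block to be processed is s k. *)
Definition deflation n m (A : 'M[R]_(m * n)) (sel : selector n m)
    (s : 'S_m) (z : {ffun 'I_m -> bool}) : 'M[R]_(n, m) :=
  deflation_loop A sel z [::] [seq s k | k <- enum 'I_m] 0.

(* For psd A, maximizers of a deflated block are orthogonal to the columns
   already computed, unless that block is zero, in which case every unit vector
   is a maximizer.  That the algorithm returns a semi-orthogonal matrix is
   therefore a condition on the choices made in the latter case; it can always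
   be met when m <= n. *)
Definition returns_semi_orthogonal n m (A : 'M[R]_(m * n))
    (sel : selector n m) : Prop :=
  forall s z, semi_orthogonal (deflation A sel s z).

(* Expectation for the uniform law on pairs (permutation, signs): the
   permutation is uniform, the signs are i.i.d. uniform, and the two are
   independent. *)
Definition expectation m (f : 'S_m -> {ffun 'I_m -> bool} -> R) : R :=
  (m`!%:R)^-1 * \sum_(s : 'S_m)
    (2 ^+ m)^-1 * \sum_(z : {ffun 'I_m -> bool}) f s z.

End Defs.

(* Main.v *)
(* Only the first processed block matters for the upper bound on the maximum:
   adding a column with a fair random sign never decreases the average
   objective, so the average over the signs is at least the top eigenvalue of
   the first diagonal block.  In a random order each block is first with
   probability 1/m, hence m times the expected objective is at least the sum of
   the top eigenvalues of the diagonal blocks, while convexity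
   bounds the objective at any U by m times that sum.  The maximum exists since
   the Stiefel manifold is compact. *)
Require Import Defs.
From mathcomp Require Import all_boot all_order all_algebra all_fingroup.
From mathcomp Require Import boolp classical_sets reals topology normedtype derive.
From mathcomp Require Import ring lra.

Set Implicit Arguments.
Unset Strict Implicit.
Unset Printing Implicit Defensive.

Import Order.TTheory GRing.Theory Num.Theory.
Import numFieldNormedType.Exports.

Local Open Scope classical_set_scope.
Local Open Scope ring_scope.

(** * Quadratic forms of stacked columns *)

Section Quadform.
Variable R : realType.

Lemma quadformE k (A : 'M[R]_k) (x : 'cV[R]_k) :
  quadform A x = \sum_i \sum_j x i 0 * A i j * x j 0.
Proof.
rewrite /quadform mxE exchange_big /=; apply: eq_bigr => j _.
by rewrite mxE mulr_suml; apply: eq_bigr => i _; rewrite mxE.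
Qed.

Lemma parallelogram k (A : 'M[R]_k) (x y : 'cV[R]_k) :
  quadform A (x + y) + quadform A (x - y) = 2 * (quadform A x + quadform A y).
Proof.
rewrite /quadform !linearD !linearN /= !(mulmxDl, mulmxDr, mulNmx, mulmxN).
by rewrite !mxE; ring.
Qed.

(* Expand the nonnegative sum of quadform A (x i - x j) over all i, j. *)
Lemma quadform_sum_le k (A : 'M[R]_k) (I : finType) (x : I -> 'cV[R]_k) :
  psd A ->
  quadform A (\sum_i x i) <= #|I|%:R * \sum_i quadform A (x i).
Proof.
move=> [_ A_ge0].
pose b u v := (u^T *m A *m v : 'M_1) 0 0.
have b_sumr u : \sum_j b u (x j) = b u (\sum_j x j).
  by rewrite /b mulmx_sumr summxE.
have b_suml v : \sum_i b (x i) v = b (\sum_i x i) v.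
  by rewrite /b linear_sum /= !mulmx_suml summxE.
have : 0 <= \sum_i \sum_j quadform A (x i - x j).
  by apply: sumr_ge0 => i _; apply: sumr_ge0 => j _; apply: A_ge0.
have -> : \sum_i \sum_j quadform A (x i - x j) =
   \sum_i \sum_j (quadform A (x i) + quadform A (x j) - b (x i) (x j) - b (x j) (x i)).
  apply: eq_bigr => i _; apply: eq_bigr => j _.
  rewrite /quadform /b !linearD !linearN /= !(mulmxDl, mulmxDr, mulNmx, mulmxN).
  by rewrite !mxE; ring.
under eq_bigr => i _ do
  rewrite !sumrB big_split /= sumr_const b_sumr b_suml -[_ *+ #|_|]mulr_natl.
rewrite !sumrB big_split /= -mulr_sumr sumr_const -[_ *+ #|_|]mulr_natl.
rewrite b_suml b_sumr -[b _ _]/(quadform A (\sum_i x i)).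
lra.
Qed.

Lemma vec_mxvec_index n m (X : 'M[R]_(n, m)) i k :
  vec X (mxvec_index i k) 0 = X k i.
Proof. by rewrite mxE mxvecE mxE. Qed.

Lemma quadform_vecE n m (A : 'M[R]_(m * n)) (X : 'M[R]_(n, m)) :
  quadform A (vec X) =
  \sum_i \sum_k \sum_j \sum_l
     X k i * A (mxvec_index i k) (mxvec_index j l) * X l j.
Proof.
rewrite quadformE (reindex _ (curry_mxvec_bij _ _)) /= [RHS]pair_bigA /=.
apply: eq_bigr => -[i k] _ /=.
rewrite (reindex _ (curry_mxvec_bij _ _)) /= [RHS]pair_bigA /=.
by apply: eq_bigr => -[j l] _ /=; rewrite !vec_mxvec_index.
Qed.

Lemma quadform_single_col n m (A : 'M[R]_(m * n)) i (v : 'cV[R]_n) :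
  quadform A (vec (set_col 0 i v)) = quadform (blk A i i) v.
Proof.
rewrite quadform_vecE quadformE (bigD1 i) //= [X in _ + X]big1 ?addr0.
  apply: eq_bigr => k _; rewrite (bigD1 i) //= [X in _ + X]big1 ?addr0.
    by apply: eq_bigr => l _; rewrite !mxE eqxx.
  by move=> j /negPf ji; apply: big1 => l _; rewrite !mxE ji mulr0.
move=> j /negPf ji; apply: big1 => k _; apply: big1 => j' _; apply: big1 => l _.
by rewrite !mxE ji !mul0r.
Qed.

Lemma vecD n m (X Y : 'M[R]_(n, m)) : vec (X + Y) = vec X + vec Y.
Proof. by rewrite /vec !linearD. Qed.

Lemma vecN n m (X : 'M[R]_(n, m)) : vec (- X) = - vec X.
Proof. by rewrite /vec !linearN. Qed.

Lemma vec0 n m : vec (0 : 'M[R]_(n, m)) = 0.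
Proof. by rewrite /vec !linear0. Qed.

Lemma vec_sum_col n m (X : 'M[R]_(n, m)) :
  vec X = \sum_i vec (set_col 0 i (col i X)).
Proof.
apply/colP => p; case/mxvec_indexP: p => i k.
rewrite vec_mxvec_index summxE (bigD1 i) //= big1 ?addr0.
  by rewrite vec_mxvec_index !mxE eqxx.
by move=> j /negPf ji; rewrite vec_mxvec_index !mxE eq_sym ji.
Qed.

(** Convexity applied to the splitting of [X] into [m] matrices with a single nonzero column: each
    of them sees only one diagonal block of [A]. *)
Lemma quadform_vec_le n m (A : 'M[R]_(m * n)) (X : 'M[R]_(n, m)) : psd A ->
  quadform A (vec X) <= m%:R * \sum_i quadform (blk A i i) (col i X).
Proof.
move=> A_psd; rewrite vec_sum_col; apply: le_trans (quadform_sum_le _ A_psd) _.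
by rewrite card_ord; under eq_bigr => i _ do rewrite quadform_single_col.
Qed.

Lemma norm2_col_semi_orthogonal n m (U : 'M[R]_(n, m)) i :
  semi_orthogonal U -> norm2 (col i U) = 1.
Proof.
move=> /matrixP/(_ i i); rewrite !mxE eqxx /= => UU; rewrite /norm2.
rewrite (_ : \sum_k _ = 1) ?sqrtr1 // -[RHS]UU.
by apply: eq_bigr => k _; rewrite !mxE expr2.
Qed.

End Quadform.

(** * Averaging over the signs *)

Lemma card_signs m : #|{ffun 'I_m -> bool}| = (2 ^ m)%N.
Proof. by rewrite card_ffun card_bool card_ord. Qed.

Section SignAverage.
Variables (R : realType) (n m : nat) (A : 'M[R]_(m * n)) (sel : selector R n m).
Hypothesis A_psd : psd A.

Definition toggle (i : 'I_m) (z : {ffun 'I_m -> bool}) : {ffun 'I_m -> bool} :=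
  [ffun j => (j == i) (+) z j].

Lemma toggleK i : involutive (toggle i).
Proof. by move=> z; apply/ffunP => j; rewrite !ffunE addbA addbb. Qed.

(** Add the sum to its reindexing by [toggle i]: this flips the bit [z i] and leaves [F b]
    unchanged, so each [z] meets both values of the bit. It amounts to conditioning on all signs but
    that of block [i]. *)
Lemma sum_toggle i (F : bool -> {ffun 'I_m -> bool} -> R) :
  (forall b z, F b (toggle i z) = F b z) ->
  2 * \sum_(z : {ffun 'I_m -> bool}) F (z i) z =
  \sum_(z : {ffun 'I_m -> bool}) (F false z + F true z).
Proof.
move=> F_toggle; rewrite mulr2n mulrDl mul1r.
rewrite [X in _ + X](reindex_inj (inv_inj (toggleK i))) -big_split /=.
apply: eq_bigr => z _; rewrite F_toggle ffunE eqxx.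
by case: (z i); rewrite //= addrC.
Qed.

(** The loop reads only the signs of blocks still to be processed. Hence, once block [i] is done,
    the rest of the run is insensitive to [z i]. *)
Lemma eq_deflation_loop (z z' : {ffun 'I_m -> bool}) processed todo Q : {in todo, z =1 z'} ->
  deflation_loop A sel z processed todo Q =
  deflation_loop A sel z' processed todo Q.
Proof.
elim: todo processed Q => //= i todo IH processed Q zz'.
rewrite zz' ?mem_head // IH // => j jtodo.
by rewrite zz' // inE jtodo orbT.
Qed.

Lemma set_colE (Q : 'M[R]_(n, m)) i v : col i Q = 0 ->
  set_col Q i v = Q + set_col 0 i v.
Proof.
move=> /colP Qi; apply/matrixP => k j; rewrite !mxE.
case: eqVneq => [->|_]; last by rewrite addr0.
by have := Qi k; rewrite !mxE => ->; rewrite add0r.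
Qed.

Lemma set_colN (i : 'I_m) (v : 'cV[R]_n) :
  set_col 0 i (- v) = - set_col 0 i v.
Proof. by apply/matrixP => k j; rewrite !mxE; case: eqP; rewrite ?oppr0. Qed.

Lemma quadform_blk_ge0 i (v : 'cV[R]_n) : 0 <= quadform (blk A i i) v.
Proof. by rewrite -quadform_single_col A_psd.2. Qed.

(* Averaging over the sign of the block i about to be processed turns Q into
   Q +- v e_i^T, so the cross terms cancel by the parallelogram identity. *)
Lemma sum_deflation_loop_ge todo processed (Q : 'M[R]_(n, m)) :
  uniq todo -> {in todo, forall j, col j Q = 0} ->
  2 ^+ m * (quadform A (vec Q) +
    if todo is i :: _ then
      quadform (blk A i i)
        (sel processed Q i (deflate (blk A i i) [seq col j Q | j <- processed]))
    else 0) <=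
  \sum_z quadform A (vec (deflation_loop A sel z processed todo Q)).
Proof.
elim: todo processed Q => [|i todo IH] processed Q /=.
  by move=> _ _; rewrite addr0 sumr_const [#|_|](card_signs m) -[leRHS]mulr_natl natrX.
move=> /andP[i_todo uniq_todo] Q0.
set v := sel processed Q i _.
(* The sign [b] of the current block is separated from the later signs, which are read from [z]. *)
pose F b z := quadform A (vec (deflation_loop A sel z (rcons processed i) todo
   (set_col Q i ((-1) ^+ b *: v)))).
have F_toggle b z : F b (toggle i z) = F b z.
  congr (quadform A (vec _)); apply: eq_deflation_loop => j jtodo.
  by rewrite ffunE; case: eqVneq => // ji; rewrite -ji jtodo in i_todo.
rewrite -(ler_pM2l (ltr0Sn R 1)) (sum_toggle F_toggle) big_split /=.
have F_ge b : 2 ^+ m * quadform A (vec (set_col Q i ((-1) ^+ b *: v))) <=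
    \sum_z F b z.
  apply: le_trans (IH _ _ uniq_todo _); last first.
    move=> j jtodo; rewrite -[RHS](Q0 j) ?inE ?jtodo ?orbT //.
    apply/colP => k; rewrite !mxE; case: eqVneq => // ji.
    by rewrite -ji jtodo in i_todo.
  (* The gain that the induction hypothesis grants for the next block is nonnegative and is dropped;
     only the gain of block [i] is kept. *)
  rewrite ler_pM2l ?exprn_gt0 // lerDl.
  by case: (todo) => // j _; exact: quadform_blk_ge0.
apply: le_trans (lerD (F_ge false) (F_ge true)).
rewrite expr0 expr1 scale1r scaleN1r.
rewrite !(@set_colE Q i) ?Q0 ?mem_head // set_colN !vecD vecN -mulrDr.
by rewrite parallelogram quadform_single_col mulrCA.
Qed.

(** The loop starts from [Q = 0], where the objective vanishes, and its first block [s i] is not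
    deflated. *)
Lemma sum_deflation_ge (i : 'I_m) (r : seq 'I_m) (s : 'S_m) :
  enum 'I_m = i :: r ->
  2 ^+ m * quadform (blk A (s i) (s i)) (sel [::] 0 (s i) (blk A (s i) (s i))) <=
  \sum_z quadform A (vec (deflation A sel s z)).
Proof.
move=> enumE.
have : uniq [seq s k | k <- enum 'I_m].
  by rewrite map_inj_uniq ?enum_uniq //; apply: perm_inj.
rewrite /deflation enumE => /(@sum_deflation_loop_ge _ [::] 0).
rewrite vec0 [quadform A 0]/quadform mulmx0 mxE add0r; apply=> j _.
exact: col0.
Qed.

End SignAverage.

(** Composing with a transposition shows that the sum is the same at every position; summing over
    all positions first, each permutation contributes the full sum of [g]. *)
Lemma sum_perm_at (R : realType) m (g : 'I_m -> R) (i : 'I_m) :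
  m%:R * \sum_(s : 'S_m) g (s i) = m`!%:R * \sum_j g j.
Proof.
have shift j : \sum_(s : 'S_m) g (s i) = \sum_(s : 'S_m) g (s j).
  rewrite (reindex_inj (mulgI (tperm j i))) /=.
  by apply: eq_bigr => s _; rewrite permM tpermR.
transitivity (\sum_(j < m) \sum_(s : 'S_m) g (s j)).
  rewrite -(eq_bigr _ (fun j _ => shift j)) sumr_const card_ord.
  by rewrite mulr_natl.
rewrite exchange_big /=.
rewrite (eq_bigr (fun=> \sum_j g j)) => [|s _]; last first.
  by rewrite [RHS](reindex_inj (@perm_inj _ s)).
by rewrite sumr_const -[LHS]mulr_natl -card_Sn.
Qed.

(** * Existence of the maximum *)

Section Compact.
Variable R : realType.

Lemma continuous_sum (T : topologicalType) (I : finType) (f : I -> T -> R) :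
  (forall i, continuous (f i)) -> continuous (fun x => \sum_i f i x).
Proof.
move=> fc x; apply: cvg_big => [|i _]; last exact: fc.
exact: add_continuous.
Qed.

Lemma coord_row_continuous n (i : 'I_n) :
  continuous (fun x : 'rV[R]_n => x 0 i).
Proof. exact: coord_continuous. Qed.

(** The set is closed, being cut out by one polynomial equation per entry, and lies in the cube
    $[-1,1]^{mn}$ because the rows of [vec_mx x] are unit vectors. Here [vec_mx x] stands for [U^T],
    so that [x^T] is [vec U]. *)
Lemma semi_orthogonal_compact n m :
  compact [set x : 'rV[R]_(m * n) | vec_mx x *m (vec_mx x)^T = 1%:M].
Proof.
have xE (x : 'rV[R]_(m * n)) i j : (vec_mx x *m (vec_mx x)^T) i j =
    \sum_k x 0 (mxvec_index i k) * x 0 (mxvec_index j k).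
  by rewrite mxE; apply: eq_bigr => k _; rewrite !mxE.
apply: (@subclosed_compact _ _
  [set x : 'rV[R]_(m * n) | forall i, `[(-1)%R, 1%R]%classic (x ord0 i)]).
- rewrite (_ : [set x | _] = \bigcap_(p in [set: 'I_m * 'I_m])
    [set x : 'rV[R]_(m * n) | \sum_k x 0 (mxvec_index p.1 k) * x 0 (mxvec_index p.2 k)
                            = (p.1 == p.2)%:R]); last first.
    rewrite predeqE => x; split=> [/matrixP xx [i j] _ /=|xx].
      by rewrite -xE xx mxE.
    by apply/matrixP => i j; rewrite xE (xx (i, j) I) mxE.
  apply: closed_bigI => -[i j] _ /=.
  apply: (continuous_closedP _).1 (@closed_eq R _) => x.
  apply: continuous_sum => k {}x; apply: continuousM; exact: coord_row_continuous.
- apply: (@rV_compact R _ (fun=> `[(-1)%R, 1%R]%classic)) => _; exact: segment_compact.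
move=> x /= xx p; case/mxvec_indexP: p => i k.
have := xE x i i; rewrite xx mxE eqxx mulr1n => /esym sum1.
rewrite in_itv /= -ler_norml -(@expr_le1 _ 2) // -normrX ger0_norm ?sqr_ge0 //.
rewrite -[leRHS]sum1 (bigD1 k) //= -expr2 lerDl; apply: sumr_ge0 => l _.
by rewrite -expr2 sqr_ge0.
Qed.

Lemma quadform_semi_orthogonal_max n m (A : 'M[R]_(m * n)) :
  @semi_orthogonal R n m !=set0 ->
  exists M, is_max [set quadform A (vec U) | U in @semi_orthogonal R n m] M.
Proof.
move=> [U0 U0o].
pose K := [set x : 'rV[R]_(m * n) | vec_mx x *m (vec_mx x)^T = 1%:M].
have vecK U : semi_orthogonal U -> K (mxvec U^T).
  by rewrite /K /= mxvecK trmxK.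
have [||c /set_mem cK cmax] := @compact_EVT_max _ R (fun x => quadform A x^T) K _
  (@semi_orthogonal_compact n m) _.
- by exists (mxvec U0^T); exact: vecK.
- apply: continuous_subspaceT => x.
  have -> : (fun x : 'rV[R]_(m * n) => quadform A x^T) =
      (fun x => \sum_i \sum_j x 0 i * A i j * x 0 j).
    apply/funext => y; rewrite quadformE.
    by apply: eq_bigr => i _; apply: eq_bigr => j _; rewrite !mxE.
  apply: continuous_sum => i {}x; apply: continuous_sum => j {}x.
  have cx p := @coord_row_continuous (m * n) p x.
  exact: (continuousM (continuousM (cx i) (@cst_continuous _ R (A i j) x)) (cx j)).
exists (quadform A c^T); split.
  exists (vec_mx c)^T; last by rewrite /vec trmxK vec_mxK.
  by rewrite /semi_orthogonal /= trmxK.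
by move=> _ [U Uo <-]; apply: cmax; exact/mem_set/vecK.
Qed.
End Compact.

(** * Monotonicity of the expectation, and its value when the signs do not matter *)

Section Expectation.
Variables (R : realType) (m : nat).
Implicit Types f : 'S_m -> {ffun 'I_m -> bool} -> R.

Lemma expectation_le f g : (forall s z, f s z <= g s z) ->
  expectation f <= expectation g.
Proof.
move=> fg; rewrite /expectation ler_wpM2l ?invr_ge0 //.
apply: ler_sum => s _; rewrite ler_wpM2l ?invr_ge0 ?exprn_ge0 //.
exact: ler_sum.
Qed.

Lemma expectation_perm (g : 'S_m -> R) :
  expectation (fun s _ => g s) = (m`!%:R)^-1 * \sum_(s : 'S_m) g s.
Proof.
congr (_ * _); apply: eq_bigr => s _.
rewrite sumr_const [#|_|](card_signs m) -[g s *+ _]mulr_natl natrX mulKf //.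
by rewrite expf_neq0 // pnatr_eq0.
Qed.

End Expectation.

Theorem proposition10 (R : realType) (n m : nat)
    (m_ge1 : (1 <= m)%N) (m_le_n : (m <= n)%N)
    (A : 'M[R]_(m * n)) (A_psd : psd A)
    (sel : selector R n m) (sel_argmax : selects_argmax sel)
    (sel_orth : returns_semi_orthogonal A sel) :
  let EQ := expectation (fun s z => quadform A (vec (deflation A sel s z))) in
  exists2 M : R,
    is_max [set quadform A (vec U) | U in @semi_orthogonal R n m] M
    & EQ <= M /\ M <= m%:R ^+ 2 * EQ.
Proof.
move=> EQ.
have fact_neq0 : m`!%:R != 0 :> R by rewrite pnatr_eq0 -lt0n fact_gt0.
have [M M_max] : exists M,
    is_max [set quadform A (vec U) | U in @semi_orthogonal R n m] M.
  apply: quadform_semi_orthogonal_max.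
  (* Any output of the algorithm is a feasible point. *)
  by exists (deflation A sel 1%g [ffun=> false]); exact: sel_orth.
exists M => //; case: M_max => -[U U_orth <-] M_ub; split.
  apply: le_trans (expectation_le (g := fun _ _ => quadform A (vec U)) _) _.
    by move=> s z; apply: M_ub; exists (deflation A sel s z).
  rewrite expectation_perm sumr_const [#|_|]card_Sn -[quadform _ _ *+ _]mulr_natl.
  by rewrite mulKf.
(* Since [m] is positive there is a first position [i]; the block processed first is then [s i]. *)
have [i [r enumE]] : exists i r, enum 'I_m = i :: r.
  by case: (enum 'I_m) (size_enum_ord m) m_ge1 => [<-|i r _ _] //; exists i, r.
(* The top eigenvalue of block [j], as attained by the selector at the start of a run. *)
pose g j := quadform (blk A j j) (sel [::] 0 j (blk A j j)).
have sum_g_le : \sum_j g j <= m%:R * EQ.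
  apply: (@le_trans _ _ (m%:R * expectation (fun (s : 'S_m) _ => g (s i)))).
    by rewrite expectation_perm mulrCA sum_perm_at mulKf.
  rewrite ler_wpM2l // expectation_perm ler_wpM2l ?invr_ge0 //.
  apply: ler_sum => s _; rewrite -ler_pdivrMl ?invr_gt0 ?exprn_gt0 // invrK.
  exact: sum_deflation_ge enumE.
(* One factor [m] comes from convexity, the other from the uniform choice of the first block in
   [sum_g_le]. The columns of [U] are unit vectors, so they compete in the maximum that [g]
   attains. *)
apply: le_trans (quadform_vec_le U A_psd) _.
rewrite expr2 -mulrA ler_wpM2l //; apply: le_trans sum_g_le.
apply: ler_sum => j _; have [_ g_max] := sel_argmax [::] 0 j (blk A j j).
by apply: g_max; exact: norm2_col_semi_orthogonal.
Qed.
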